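(* For every graph $H$ with $t$ vertices, every graph $G$ that does not contain $H$ as a weak immersion has a tree decomposition with adhesion at most $t^2$ such that every torso has $(t,\,t^4+2t^2)$-bounded degree.
   Context: All graphs are finite and simple. $G$ contains $H$ as a weak immersion (immersion) if the vertices of $H$ can be mapped to distinct vertices of $G$ and the edges of $H$ to pairwise edge-disjoint paths in $G$, each edge $vw$ of $H$ mapped to a path whose endpoints are the images of $v$ and $w$. For a tree $T$, a $T$-decomposition (tree decomposition) of $G$ is a collection $(T_x\subseteq V(G):x\in V(T))$ of bags such that for each $v\in V(G)$, $\{x: v\in T_x\}$ induces a connected subtree of $T$, and each edge of $G$ has both endpoints in some bag. Its adhesion is $\max\{|T_x\cap T_y|: xy\in E(T)\}$. The torso of a node $x$ is the graph obtained from $G[T_x]$ by adding a clique on $T_x\cap T_y$ for each edge $xy\in E(T)$ incident to $x$. For integers $c,d\ge 0$, a graph has $(c,d)$-bounded degree if it contains at most $c$ vertices of degree greater than $d$. *)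

(* Defs.v *)
From mathcomp Require Import all_boot.

Set Implicit Arguments.
Unset Strict Implicit.
Unset Printing Implicit Defensive.

Record sgraph := SGraph {
  vertex :> finType;
  adj : rel vertex;
  adj_sym : symmetric adj;
  adj_irrefl : irreflexive adj
}.

Notation "x -- y" := (adj x y) (at level 30, no associativity).

Definition edges (G : sgraph) : {set {set G}} :=
  [set [set p.1; p.2] | p : G * G & p.1 -- p.2].

Definition degree (G : sgraph) (v : G) : nat := #|[set w : G | v -- w]|.

Definition bounded_degree (c d : nat) (G : sgraph) : Prop :=
  #|[set v : G | d < degree v]| <= c.

Section Induced.
Variables (G : sgraph) (A : {set G}).

Definition induced_adj : rel {v : G | v \in A} :=
  fun u v => val u -- val v.

Lemma induced_adj_sym : symmetric induced_adj.
Proof. by move=> u v; apply: adj_sym. Qed.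

Lemma induced_adj_irrefl : irreflexive induced_adj.
Proof. by move=> u; apply: adj_irrefl. Qed.

Definition induced : sgraph := SGraph induced_adj_sym induced_adj_irrefl.

End Induced.

(* A path is given by the sequence of all its vertices, both ends included. *)
Definition is_path (G : sgraph) (x y : G) (p : seq G) : Prop :=
  exists q : seq G,
    [/\ p = x :: q, path (@adj G) x q, last x q = y & uniq p].

Definition path_edges (G : sgraph) (p : seq G) : seq {set G} :=
  if p is x :: q then pairmap (fun u v => [set u; v]) x q else [::].

(* Edges of H are unordered, so [P [set v; w]] may list its path from either
   end. *)
Definition weak_immersion (H G : sgraph) : Prop :=
  exists (f : H -> G) (P : {set H} -> seq G),
    [/\ injective f,
        forall v w : H, v -- w ->
          is_path (f v) (f w) (P [set v; w]) \/
          is_path (f w) (f v) (P [set v; w])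
      & forall e1 e2 : {set H}, e1 \in edges H -> e2 \in edges H -> e1 != e2 ->
          forall e : {set G},
            ~ (e \in path_edges (P e1) /\ e \in path_edges (P e2))].

(* The null graph is not connected. *)
Definition connected_graph (G : sgraph) : Prop :=
  0 < #|G| /\ forall x y : G, connect (@adj G) x y.

(* [ucycle] also accepts sequences of size at most 2 (the empty sequence and
   the two ends of an edge), which are not cycles of a simple graph. *)
Definition acyclic (G : sgraph) : Prop :=
  forall c : seq G, ucycle (@adj G) c -> size c <= 2.

Definition is_tree (T : sgraph) : Prop := connected_graph T /\ acyclic T.

Definition tree_decomposition (G T : sgraph) (B : T -> {set G}) : Prop :=
  [/\ is_tree T,
      forall v : G, connected_graph (induced [set x : T | v \in B x])
    & forall u v : G, u -- v -> exists x : T, u \in B x /\ v \in B x].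

Definition adhesion (G T : sgraph) (B : T -> {set G}) : nat :=
  \max_(p : T * T | p.1 -- p.2) #|B p.1 :&: B p.2|.

Section Torso.
Variables (G T : sgraph) (B : T -> {set G}) (x : T).

Definition torso_adj : rel (induced (B x)) :=
  fun u v => u -- v ||
    (u != v) && [exists y : T, [&& x -- y, val u \in B x :&: B y
                                         & val v \in B x :&: B y]].

Lemma torso_adj_sym : symmetric torso_adj.
Proof.
move=> u v; rewrite /torso_adj adj_sym eq_sym; congr (_ || _ && _).
by apply: eq_existsb => y; rewrite [X in _ && X]andbC.
Qed.

Lemma torso_adj_irrefl : irreflexive torso_adj.
Proof. by move=> u; rewrite /torso_adj adj_irrefl eqxx. Qed.

Definition torso : sgraph := SGraph torso_adj_sym torso_adj_irrefl.

End Torso.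

(* Main.v *)
Require Import Defs.
From mathcomp Require Import all_boot zify.

Set Implicit Arguments.
Unset Strict Implicit.
Unset Printing Implicit Defensive.

(* Call a set X of vertices a separator of u and v if it contains exactly one of
   them. Breaking ties between cut sizes by an injective modular weight makes the
   minimum separator of each pair unique, and uncrossing shows that all these
   minimum separators form a laminar family. Keep those with at most t^2 leaving
   edges, add the whole vertex set, and order the members into a rooted tree by
   inclusion. The bag of a member A consists of its core (the vertices of A in no
   smaller member) and, for each child C of A, the vertices of C with a neighbour
   outside C. Adhesion sets are then boundaries of members, and a vertex of the
   bag outside the core has torso degree at most 3 t^2.

   Two vertices of the same core are separated by no cut of at most t^2 edges. If
   a core had more than t vertices, one of them could serve as a hub, joined by
   edge-disjoint paths, t to each of t others; pairing up these paths at
   the hub would immerse every graph on t vertices. *)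

(** * In-degrees of vertex sets and their submodularity *)

Lemma card_set_sum (T : finType) (D : {set T}) (P : pred T) :
  #|[set a in D | P a]| = \sum_(a in D) P a.
Proof.
rewrite -sum1_card big_mkcond /= [RHS]big_mkcond /=.
by apply: eq_bigr => a _; rewrite !inE; case: (a \in D) => //=; case: (P a).
Qed.

Section InDegree.
Variable T : finType.
Implicit Types (D : {set T * T}) (X Y : {set T}).

Definition indeg D X := #|[set a in D | (a.1 \notin X) && (a.2 \in X)]|.

(** Checked arc by arc. The third summand collects arcs that uncrossing loses; it makes the
    inequality strict in [feasible_orientation]. *)
Lemma indeg_submod D X Y :
  indeg D (X :&: Y) + indeg D (X :|: Y)
    + #|[set a in D | (a.1 \in Y :\: X) && (a.2 \in X :\: Y)]|
  <= indeg D X + indeg D Y.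
Proof.
rewrite /indeg !card_set_sum -!big_split /=; apply: leq_sum => a _; rewrite !inE.
by case: (a.1 \in X); case: (a.1 \in Y); case: (a.2 \in X); case: (a.2 \in Y).
Qed.

Lemma indegD1 D X a : a \in D ->
  indeg D X = ((a.1 \notin X) && (a.2 \in X)) + indeg (D :\ a) X.
Proof.
move=> aD; rewrite /indeg !card_set_sum (bigD1 a) //=; congr (_ + _).
by apply: eq_bigl => b; rewrite !inE andbC.
Qed.

Lemma indeg0 D : indeg D set0 = 0.
Proof. by apply: eq_card0 => a; rewrite !inE !andbF. Qed.

End InDegree.

(** * Arc-disjoint paths from a source to prescribed ends *)

Section Menger.
Variables (T I : finType) (s : T).
Implicit Types (D : {set T * T}) (y : I -> T) (X Y : {set T}).

Definition load y X := #|[set i | y i \in X]|.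

Lemma load_mod y X Y :
  load y (X :&: Y) + load y (X :|: Y) = load y X + load y Y.
Proof.
rewrite addnC /load -[RHS]cardsUI.
by congr (_ + _); apply: eq_card => i; rewrite !inE.
Qed.

(** The cut condition of Menger's theorem for arc-disjoint paths from [s], the i-th one ending at
    [y i]. *)
Definition feasible D y :=
  [forall X : {set T}, (s \notin X) ==> (load y X <= indeg D X)].

Lemma feasibleP D y :
  reflect (forall X, s \notin X -> load y X <= indeg D X) (feasible D y).
Proof. by apply: (iffP forallP) => h X; apply/implyP; apply: h. Qed.

(** Deleting an arc into [y i0] and moving that end to its tail z can only break the condition at a
    tight set that contains z but not [y i0]. By submodularity the union W of the tight sets
    avoiding [y i0] is tight, so it suffices to choose z outside W. *)
Lemma feasible_step D y i0 : feasible D y -> y i0 != s ->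
  exists2 z, (z, y i0) \in D &
    feasible (D :\ (z, y i0)) (fun i => if i == i0 then z else y i).
Proof.
move=> /feasibleP fD ys.
pose tight X := [&& s \notin X, y i0 \notin X & load y X == indeg D X].
pose W := \bigcup_(X | tight X) X.
have tW : tight W.
  rewrite /W; apply: (big_ind tight) => //.
    rewrite /tight !inE /= indeg0 /load; apply/eqP/eq_card0 => i.
    by rewrite !inE.
  move=> X Y /and3P[sX yX /eqP lX] /and3P[sY yY /eqP lY].
  have sU : s \notin X :|: Y by rewrite inE negb_or sX.
  have sI : s \notin X :&: Y by rewrite inE negb_and sX.
  rewrite /tight sU inE negb_or yX yY /=.
  move: (fD _ sU) (fD _ sI) (load_mod y X Y) (indeg_submod D X Y); lia.
have [z zD zW] : exists2 z, (z, y i0) \in D & z \notin W.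
  case: (boolP [exists z, ((z, y i0) \in D) && (z \notin W)]) => [|/existsPn no].
    by case/existsP=> z /andP[]; exists z.
  case/and3P: tW => sW yW /eqP lW.
  (* If every arc into [y i0] came from W, adding [y i0] to W would raise the load but not the
     in-degree, violating feasibility. *)
  have sU : s \notin y i0 |: W by rewrite !inE negb_or eq_sym ys.
  have lt_load : load y W < load y (y i0 |: W).
    apply/proper_card/properP; split.
      by apply/subsetP => i; rewrite !inE => ->; rewrite orbT.
    by exists i0; rewrite !inE ?eqxx.
  have le_in : indeg D (y i0 |: W) <= indeg D W.
    apply/subset_leq_card/subsetP => -[u v].
    rewrite !inE /= negb_or => /and3P[uvD /andP[_ uW]].
    rewrite uvD uW /= => /orP[/eqP ev|//].
    by move: (no u); rewrite -ev uvD uW.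
  by move: (fD _ sU); lia.
exists z => //; apply/feasibleP => X sX.
have lE u : load (fun i => if i == i0 then u else y i) X
    = (u \in X) + #|[set i | (i != i0) && (y i \in X)]|.
  rewrite /load (cardsD1 i0) !inE eqxx; congr (_ + _).
  by apply: eq_card => i; rewrite !inE; case: eqP.
(* For u = [y i0] the modified map is y itself, so [load y X] gets the same remainder term. *)
have := lE (y i0); rewrite {1}/load.
rewrite (_ : [set i | _] = [set i | y i \in X]); last first.
  by apply/setP => i; rewrite !inE; case: eqP => // ->.
rewrite lE -/(load y X) => lX; have := fD X sX.
have nt : z \in X -> y i0 \notin X -> load y X != indeg D X.
  move=> zX yX; apply: contraNneq zW => tX.
  by apply/bigcupP; exists X; rewrite // /tight sX yX tX eqxx.
move: nt; rewrite lX (indegD1 X zD) /=.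
set d := indeg _ _; set c := #|_|.
by case: (y i0 \in X); case: (z \in X) => /= nt; lia.
Qed.

(* The path to [y i0] is shortened by its last arc, which is then deleted. *)
Lemma feasible_disjoint_paths D y : feasible D y ->
  exists F : I -> {set T * T},
    [/\ forall i, F i \subset D,
        forall i j a, a \in F i -> a \in F j -> i = j
      & forall i, connect (fun u v => (u, v) \in F i) s (y i)].
Proof.
have [n] := ubnP #|D|; elim: n D y => // n IH D y leD fD.
case: (boolP [exists i, y i != s]) => [/existsP[i0 yi0]|/existsPn y_s]; last first.
  exists (fun=> set0); split=> [i|i j a|i]; rewrite ?sub0set ?inE //.
  by move/eqP: (negbNE (y_s i)) => ->.
have [z zD fD'] := feasible_step fD yi0.
have {IH fD'} [|F [sF dF cF]] := IH _ _ _ fD'.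
  by move: leD; rewrite (cardsD1 (z, y i0) D) zD.
have aF i : (z, y i0) \notin F i.
  by apply: contraTN (zD) => /(subsetP (sF i)); rewrite !inE eqxx.
exists (fun i => if i == i0 then (z, y i0) |: F i else F i); split.
- move=> i; have sFD : F i \subset D := subset_trans (sF i) (subsetDl _ _).
  by case: eqP => // _; rewrite subUset sub1set zD.
- move=> i j a; case: eqP => [->|_]; case: eqP => [->|_] //.
  + rewrite in_setU1 => /orP[/eqP->|]; last exact: dF.
    by rewrite (negPf (aF _)).
  + rewrite in_setU1 => aFi /orP[/eqP ea|]; last exact: dF.
    by move: aFi; rewrite ea (negPf (aF _)).
  + exact: dF.
- move=> i; have := cF i; case: eqP => [->|//] c0.
  apply: (@connect_trans _ _ z).
    by apply: connect_sub c0 => u v uv; apply: connect1; rewrite in_setU1 uv orbT.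
  by apply: connect1; rewrite setU11.
Qed.

(* If both (u, v) and (v, u) were needed, the two tight sets witnessing it
   would contradict submodularity. *)
Lemma feasible_orientation D y : feasible D y ->
  exists2 D' : {set T * T}, D' \subset D &
    feasible D' y /\ forall u v, (u, v) \in D' -> (v, u) \notin D'.
Proof.
move=> fD; have [D' /minsetP[fD' minD'] sD'] :=
  @minset_exists _ (fun D => feasible D y) D fD.
exists D' => //; split=> // u v uv; apply/negP => vu.
have wit a : a \in D' -> exists X,
    [/\ s \notin X, a.1 \notin X, a.2 \in X & load y X = indeg D' X].
  move=> aD; have : ~~ feasible (D' :\ a) y.
    apply/negP => /minD'; rewrite subsetDl => /(_ isT) eD.
    by move: aD; rewrite -eD !inE eqxx.
  case/forallPn=> X; rewrite negb_imply -ltnNge => /andP[sX].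
  move/feasibleP: fD' => /(_ X sX); rewrite (indegD1 X aD).
  case: (boolP (a.1 \in X)) => aX1; case: (boolP (a.2 \in X)) => aX2 /=; try lia.
  by exists X; split=> //; rewrite (indegD1 X aD) aX1 aX2 /=; lia.
have [X [sX /= uX vX tX]] := wit _ uv; have [Y [sY /= vY uY tY]] := wit _ vu.
(* The arc (u, v) runs from Y \ X to X \ Y, so the third summand is positive, while X and Y are both
   tight. *)
have := indeg_submod D' X Y.
rewrite (cardsD1 (u, v)) !inE uv /= uX vX uY vY /=.
move/feasibleP: fD' => fD'.
have : s \notin X :|: Y by rewrite inE negb_or sX.
have : s \notin X :&: Y by rewrite inE negb_and sX.
move=> /fD' + /fD'; have := load_mod y X Y; lia.
Qed.

End Menger.

(** * Immersions built from edge-disjoint connections *)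

Section Immersion.
Variables G H : sgraph.

Definition arcs : {set G * G} := [set a | a.1 -- a.2].

(** Each edge gives two opposite arcs, exactly one of which enters X if the edge crosses, so
    crossing edges are counted once. *)
Definition cut (X : {set G}) := indeg arcs X.

Lemma mem_path_edges (e : rel G) x p (E : {set G}) :
  path e x p -> E \in path_edges (x :: p) ->
  exists u v, E = [set u; v] /\ e u v.
Proof.
elim: p x => //= y p IH x /andP[exy pp]; rewrite inE => /orP[/eqP->|].
  by exists x, y.
exact: IH.
Qed.

Lemma set2_inj (T : finType) (a b c d : T) :
  [set a; b] = [set c; d] -> (a = c /\ b = d) \/ (a = d /\ b = c).
Proof.
move=> E.
have : a \in [set c; d] by rewrite -E set21.
have : b \in [set c; d] by rewrite -E set22.
have : c \in [set a; b] by rewrite E set21.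
have : d \in [set a; b] by rewrite E set22.
by do 4![case/set2P=> ?]; subst; auto.
Qed.

(** [R e] is the set of edges reserved for e. Mere connectivity within it suffices, because a walk
    can be shortened to a path using only its own edges. *)
Lemma immersion_of_disjoint_relations (f : H -> G) (R : {set H} -> rel G) :
  injective f ->
  (forall e, symmetric (R e)) ->
  (forall e, subrel (R e) (@adj G)) ->
  (forall e1 e2 u v, R e1 u v -> R e2 u v -> e1 = e2) ->
  (forall v w, v -- w -> connect (R [set v; w]) (f v) (f w)) ->
  weak_immersion H G.
Proof.
move=> injf Rsym Radj Rdisj Rconn.
have [|P hP] := @fin_all_exists {set H} (fun=> seq G) (fun e p =>
    (forall v w, e = [set v; w] -> v -- w ->
       is_path (f v) (f w) p \/ is_path (f w) (f v) p) /\
    (forall E, e \in edges H -> E \in path_edges p ->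
       exists u v, E = [set u; v] /\ R e u v)).
  move=> e; case: (boolP (e \in edges H)) => [/imsetP[[v w]]|eN]; last first.
    (* Sets that are not edges of H receive a dummy path. *)
    exists [::]; split=> // v w ee vw; case/negP: eN.
    by apply/imsetP; exists (v, w); rewrite ?inE.
  rewrite inE /= => vw ->; have /connectP[p0 pp0 lp0] := Rconn _ _ vw.
  case: (shortenP pp0) lp0 => p pp up _ lp {p0 pp0}.
  have isP : is_path (f v) (f w) (f v :: p).
    by exists p; split=> //; apply: sub_path pp; apply: Radj.
  exists (f v :: p); split; last by move=> E _; apply: mem_path_edges.
  by move=> v' w' /set2_inj[[<- <-]|[<- <-]] _; [left|right].
exists f, P; split=> // [v w vw|e1 e2 e1H e2H ne E [E1 E2]].
  exact: (hP _).1.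
have [u [v [Euv R1]]] := (hP e1).2 _ e1H E1.
have [u' [v' [Euv' R2]]] := (hP e2).2 _ e2H E2.
case/eqP: ne; apply: Rdisj R1 _.
by move: Euv'; rewrite Euv => /set2_inj[[-> ->]|[-> ->]]; rewrite // Rsym.
Qed.

(* The paths to the hub [s] are indexed by [H * H]: the edge vw of H is routed
   along the paths (v, w) and (w, v). *)
Lemma immersion_of_hub (s : G) (f : H -> G) :
  injective f ->
  (forall X : {set G}, s \notin X -> (exists v, f v \in X) ->
     #|H| ^ 2 <= cut X) ->
  weak_immersion H G.
Proof.
move=> injf hub; pose y (i : H * H) := f i.1.
have fD : feasible s arcs y.
  apply/feasibleP => X sX.
  case: (boolP [exists v, f v \in X]) => [/existsP exv|/existsPn no].
    apply: leq_trans (hub X sX exv); rewrite -mulnn -card_prod.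
    exact: max_card.
  rewrite /load eq_card0 // => i; rewrite !inE; exact/negbTE/no.
have [D sD [{}fD antiD]] := feasible_orientation fD.
have [F [sF dF cF]] := feasible_disjoint_paths fD.
pose S i u v := ((u, v) \in F i) || ((v, u) \in F i).
pose R (e : {set H}) u v := [exists i : H * H, (e == [set i.1; i.2]) && S i u v].
have Ssym i : symmetric (S i) by move=> u v; rewrite /S orbC.
have Sconn i : connect (S i) s (y i).
  by apply: connect_sub (cF i) => u v uv; apply: connect1; rewrite /S uv.
apply: (@immersion_of_disjoint_relations f R) => //.
- by move=> e u v; apply: eq_existsb => i; rewrite Ssym.
- move=> e u v /existsP[i /andP[_ /orP[]]] /(subsetP (sF i)) /(subsetP sD);
    rewrite inE //=.
  by rewrite adj_sym.
- move=> e1 e2 u v /existsP[i /andP[/eqP-> Si]] /existsP[j /andP[/eqP-> Sj]].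
  suff -> : i = j by [].
  (* Arc-disjointness gives edge-disjointness because D never contains both orientations of an
     edge. *)
  have no a b : (a, b) \in F i -> (b, a) \in F j -> i = j.
    by move=> /(subsetP (sF i)) /antiD/negP + /(subsetP (sF j)).
  by case/orP: Si => Si; case/orP: Sj => Sj; eauto.
- move=> v w _; have Rsym : connect_sym (R [set v; w]).
    by apply: sym_connect_sym => a b; apply: eq_existsb => i; rewrite Ssym.
  have toR i : [set v; w] = [set i.1; i.2] -> connect (R [set v; w]) s (y i).
    move=> ei; apply: connect_sub (Sconn i) => a b Sab.
    by apply: connect1; apply/existsP; exists i; rewrite ei eqxx.
  apply: (@connect_trans _ _ s); first by rewrite Rsym; apply: (toR (v, w)).
  by apply: (toR (w, v)); rewrite setUC.
Qed.

End Immersion.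

(** * Uncrossing minimum separators *)

Section Laminar.
Variable T : finType.
Implicit Types (X Y : {set T}) (L : {set {set T}}).

Definition separates X u v := (u \in X) != (v \in X).

Lemma separatesC X u v : separates X u v = separates X v u.
Proof. by rewrite /separates eq_sym. Qed.

Definition min_separator (f : {set T} -> nat) X :=
  [exists u, exists v, separates X u v &&
    [forall Y : {set T}, separates Y u v ==> (f X <= f Y)]].

Lemma min_separatorP f X :
  reflect (exists u v, [/\ u \in X, v \notin X
             & forall Y, separates Y u v -> f X <= f Y])
          (min_separator f X).
Proof.
apply: (iffP existsP) => [[u /existsP[v /andP[uv /forallP minX]]]|].
  have {}minX Y : separates Y u v -> f X <= f Y by apply/implyP/minX.
  move: (uv); rewrite {1}/separates.
  case: (boolP (u \in X)) => uX; case: (boolP (v \in X)) => vX // _.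
    by exists u, v.
  by exists v, u; split=> // Y; rewrite separatesC; apply: minX.
case=> u [v [uX vX minX]]; exists u; apply/existsP; exists v.
rewrite /separates uX (negPf vX) /=; apply/forallP => Y; apply/implyP.
exact: minX.
Qed.

Definition laminar L := forall X Y, X \in L -> Y \in L ->
  [\/ X \subset Y, Y \subset X | [disjoint X & Y]].

(** Let X be minimum for (u, v), Y for (a, b), and f X < f Y. Then X cannot separate a from b.
    According to the side of X holding a and b, and to whether v or u lies in Y, one of the two
    inequalities yields a separator of u, v and one of a, b of total value at most f X + f Y.
    Minimality and injectivity make them X and Y themselves, which forces the required relation. *)
Lemma min_separator_laminar (f : {set T} -> nat) :
  injective f ->
  (forall X Y, f (X :&: Y) + f (X :|: Y) <= f X + f Y) ->
  (forall X Y, f (X :\: Y) + f (Y :\: X) <= f X + f Y) ->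
  laminar [set X | min_separator f X].
Proof.
move=> injf submod posimod X Y; rewrite !inE.
wlog ltXY : X Y / f X < f Y => [wl mX mY|].
  have [lt|lt|/injf->] := ltngtP (f X) (f Y); first exact: wl.
    case: (wl Y X lt mY mX) => h; [by constructor 2|by constructor 1|].
    by constructor 3; rewrite disjoint_sym.
  by constructor 1.
case/min_separatorP=> u [v [uX vX minX]] /min_separatorP[a [b [aY bY minY]]].
have eqI Z Z' : separates Z u v -> separates Z' a b ->
    f Z + f Z' <= f X + f Y -> Z = X /\ Z' = Y.
  by move=> /minX h1 /minY h2 h; split; apply: injf; lia.
have : ~~ separates X a b by apply/negP => /minY; lia.
rewrite /separates negbK; case: (boolP (a \in X)) => aX /eqP/esym bX.
- case: (boolP (v \in Y)) => vY.
  + have [|||E _] := eqI (Y :\: X) (X :\: Y); rewrite /separates ?inE.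
    * by rewrite uX vX vY.
    * by rewrite aY bX bY.
    * by rewrite addnC; apply: posimod.
    by move: (uX); rewrite -E !inE uX.
  + have [|||E _] := eqI (X :|: Y) (X :&: Y); rewrite /separates ?inE.
    * by rewrite uX (negPf vX) (negPf vY).
    * by rewrite aX aY bX (negPf bY).
    * by rewrite addnC; apply: submod.
    by constructor 2; rewrite -E subsetUr.
- case: (boolP (u \in Y)) => uY.
  + have [|||_ E] := eqI (X :&: Y) (X :|: Y); rewrite /separates ?inE //.
    * by rewrite uX uY (negPf vX).
    * by rewrite aY bX (negPf bY) orbT.
    by constructor 1; rewrite -E subsetUl.
  + have [|||E _] := eqI (X :\: Y) (Y :\: X); rewrite /separates ?inE //.
    * by rewrite uX uY (negPf vX) andbF.
    * by rewrite aX aY (negPf bY) andbF.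
    by constructor 3; rewrite -E -setI_eq0; apply/eqP/setP => x;
      rewrite !inE; case: (x \in Y); rewrite ?andbF.
Qed.

End Laminar.

(** * An injective modular weight on sets *)

Section Weight.

Lemma binary_inj n (a b : 'I_n -> bool) :
  \sum_(i < n) a i * 2 ^ i = \sum_(i < n) b i * 2 ^ i -> a =1 b.
Proof.
elim: n a b => [|n IH] a b; first by move=> _ [].
have dbl (c : 'I_n.+1 -> bool) :
    \sum_(i < n.+1) c i * 2 ^ i
      = c ord0 + (\sum_(i < n) c (lift ord0 i) * 2 ^ i).*2.
  rewrite big_ord_recl muln1 -muln2 big_distrl /=; congr (_ + _).
  by apply: eq_bigr => i _; rewrite /bump /= expnS; lia.
rewrite !dbl => E.
have E0 : a ord0 = b ord0.
  by move/(congr1 odd): E; rewrite !oddD !odd_double !addbF !oddb.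
have {E}/IH E1 : \sum_(i < n) a (lift ord0 i) * 2 ^ i
    = \sum_(i < n) b (lift ord0 i) * 2 ^ i by move: E; rewrite E0; lia.
move=> i; case: (unliftP ord0 i) => [j|] -> //; exact: E1.
Qed.

Variable T : finType.
Implicit Types X Y : {set T}.

(** The indicator function of X read as a binary numeral. *)
Definition weight X := \sum_(i < #|T|) (enum_val i \in X) * 2 ^ i.

Lemma weight_inj : injective weight.
Proof.
by move=> X Y /binary_inj E; apply/setP => x; rewrite -(enum_rankK x) E.
Qed.

Lemma weight_leT X : weight X <= weight [set: T].
Proof. by apply: leq_sum => i _; rewrite inE leq_mul2r leq_b1 orbT. Qed.

Lemma weight_mod X Y :
  weight (X :&: Y) + weight (X :|: Y) = weight X + weight Y.
Proof.
rewrite /weight -!big_split /=; apply: eq_bigr => i _; rewrite -!mulnDl !inE.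
by case: (_ \in X); case: (_ \in Y).
Qed.

Lemma weight_posimod X Y :
  weight (X :\: Y) + weight (Y :\: X) <= weight X + weight Y.
Proof.
rewrite /weight -!big_split /=; apply: leq_sum => i _.
rewrite -!mulnDl leq_mul2r !inE.
by case: (_ \in X); case: (_ \in Y); rewrite orbT.
Qed.

End Weight.

(** * The laminar family of small minimum cuts *)

Section CutWeight.
Variable G : sgraph.
Implicit Types X Y : {set G}.

Lemma cutC X : cut (~: X) = cut X.
Proof.
rewrite /cut /indeg -(card_imset _ (inv_inj (@swap_pairK G G))).
rewrite (can_imset_pre _ (@swap_pairK G G)); apply: eq_card => a.
by rewrite !inE /= adj_sym negbK [X in _ && X]andbC.
Qed.

Lemma cut_submod X Y : cut (X :&: Y) + cut (X :|: Y) <= cut X + cut Y.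
Proof. exact: leq_trans (leq_addr _ _) (indeg_submod _ X Y). Qed.

Lemma cut_posimod X Y : cut (X :\: Y) + cut (Y :\: X) <= cut X + cut Y.
Proof.
have := cut_submod X (~: Y); rewrite cutC -setDE.
by rewrite -(cutC (X :|: ~: Y)) setCU setCK setIC -setDE.
Qed.

(* The cut size, with ties between sets broken by an injective modular
   weight. *)
Definition cut_weight X := (weight [set: G]).+1 * cut X + weight X.

Lemma cut_weight_inj : injective cut_weight.
Proof.
move=> X Y /(congr1 (modn ^~ (weight [set: G]).+1)).
rewrite /cut_weight ![_.+1 * _]mulnC !modnMDl !modn_small ?ltnS ?weight_leT //.
exact: weight_inj.
Qed.

Lemma cut_weight_le X k :
  (cut_weight X < (weight [set: G]).+1 * k.+1) = (cut X <= k).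
Proof.
by have := weight_leT X; rewrite /cut_weight => wX; apply/idP/idP => h; nia.
Qed.

Lemma cut_weight_laminar : laminar [set X | min_separator cut_weight X].
Proof.
apply: min_separator_laminar => [|X Y|X Y]; first exact: cut_weight_inj.
  have := cut_submod X Y; have := weight_mod X Y; rewrite /cut_weight; nia.
have := cut_posimod X Y; have := weight_posimod X Y; rewrite /cut_weight; nia.
Qed.

Variable k : nat.

Definition cut_family : {set {set G}} :=
  setT |: [set X | min_separator cut_weight X && (cut X <= k)].

Lemma cut_family_laminar : laminar cut_family.
Proof.
move=> X Y; rewrite !inE.
move=> /orP[/eqP->|/andP[mX _]]; first by move=> _; constructor 2.
move=> /orP[/eqP->|/andP[mY _]]; first by constructor 1.
by apply: cut_weight_laminar; rewrite inE.
Qed.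

Lemma cut_family_cut X : X \in cut_family -> cut X <= k.
Proof.
rewrite !inE => /orP[/eqP->|/andP[]//].
by rewrite /cut /indeg eq_card0 // => a; rewrite !inE andbF.
Qed.

(** If G has no vertices, [setT] is an empty member, hence the disjunction. *)
Lemma cut_family_neq0 X : X \in cut_family -> X = setT \/ X != set0.
Proof.
rewrite !inE => /orP[/eqP->|/andP[/min_separatorP[u [v [uX _ _]]] _]]; first by left.
by right; apply/set0Pn; exists u.
Qed.

Lemma cut_family_separates X u v : cut X <= k -> separates X u v ->
  exists2 Y, Y \in cut_family & separates Y u v.
Proof.
move=> cX sX.
have [Y sY minY] := @arg_minnP _ X (fun X => separates X u v) cut_weight sX.
exists Y => //; rewrite !inE; apply/orP; right; apply/andP; split.
  apply/existsP; exists u; apply/existsP; exists v; rewrite sY.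
  by apply/forallP => Z; apply/implyP; apply: minY.
by move: cX; rewrite -!cut_weight_le; apply: leq_ltn_trans; apply: minY.
Qed.

End CutWeight.

(** * The tree decomposition given by a laminar family *)

Section LaminarTree.
Variables (G : sgraph) (L : {set {set G}}).
Hypotheses (lamL : laminar L) (LT : [set: G] \in L).
Hypothesis L_neq0 : forall A, A \in L -> A = setT \/ A != set0.
Local Notation node := {A : {set G} | A \in L}.
Implicit Types A C D : node.

Definition covers A C :=
  (val A \proper val C) &&
  [forall D : node,
     (val A \proper val D) ==> ~~ (val D \proper val C)].

(** The tree is the Hasse diagram of inclusion on L. *)
Definition tree_adj A C := covers A C || covers C A.

Lemma tree_adj_sym : symmetric tree_adj.
Proof. by move=> A C; rewrite /tree_adj orbC. Qed.

Lemma tree_adj_irrefl : irreflexive tree_adj.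
Proof. by move=> A; rewrite /tree_adj /covers properxx. Qed.

Definition laminar_tree := SGraph tree_adj_sym tree_adj_irrefl.

Lemma common_nested A C v : v \in val A -> v \in val C ->
  val A \subset val C \/ val C \subset val A.
Proof.
move=> vA vC; case: (lamL (valP A) (valP C)) => [||dAC]; [by left|by right|].
by move: (disjointFr dAC vA); rewrite vC.
Qed.

Lemma proper_nonempty A C : val A \proper val C -> exists v, v \in val A.
Proof.
case: (L_neq0 (valP A)) => [->|/set0Pn//].
by rewrite properE subsetT andbF.
Qed.

(** Two covers of A share a vertex of A, so laminarity nests them, and neither can lie strictly
    between A and the other. *)
Lemma covers_uniq A C D : covers A C -> covers A D -> C = D.
Proof.
wlog CD : C D / val C \subset val D => [wl hAC AD|].
  have [pAC _] := andP hAC; have [pAD _] := andP AD.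
  have [v vA] := proper_nonempty pAC.
  have vC := subsetP (proper_sub pAC) _ vA.
  have vD := subsetP (proper_sub pAD) _ vA.
  by have [CD|DC] := common_nested vC vD; [apply: wl|apply/esym; apply: wl].
move=> /andP[hAC _] /andP[_ /forallP/(_ C)]; rewrite hAC /= => nCD.
apply/val_inj/eqP; rewrite eqEsubset CD /=.
by apply: contraNT nCD => DC; rewrite properE CD.
Qed.

Lemma cover_exists A C : val A \proper val C ->
  exists2 D : node, covers A D & val D \subset val C.
Proof.
move=> hAC.
have [D AD minD] := @arg_minnP _ C (fun D : node => val A \proper val D)
  (fun D : node => #|val D|) hAC.
have [v vA] := proper_nonempty hAC.
exists D.
  rewrite /covers AD; apply/forallP => E; apply/implyP => /minD leDE.
  by apply/negP => /proper_card; rewrite ltnNge leDE.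
have vD := subsetP (proper_sub AD) _ vA.
have vC := subsetP (proper_sub hAC) _ vA.
case: (common_nested vD vC) => // CD.
have /eqP -> // : val C == val D.
by rewrite eqEcard CD minD.
Qed.

Lemma cocover_exists A v : v \in val A ->
  (exists2 C : node, val C \proper val A & v \in val C) ->
  exists2 C : node, covers C A & v \in val C.
Proof.
move=> vA [C0 pC0 vC0].
have [|C /andP[CA vC] maxC] := @arg_maxnP _ C0
  (fun C : node => (val C \proper val A) && (v \in val C)) (fun C : node => #|val C|).
  by rewrite pC0.
exists C => //; rewrite /covers CA; apply/forallP => D; apply/implyP => CD.
apply/negP => DA; have := proper_card CD; rewrite ltnNge => /negP; apply.
by apply: maxC; rewrite DA (subsetP (proper_sub CD)).
Qed.

(* Climbing from A to its successive covers stays between A and C. *)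
Lemma interval_connect (P : {set laminar_tree}) (A C : induced P) :
  val (val A) \subset val (val C) ->
  (forall D : laminar_tree, val (val A) \subset val D -> val D \subset val (val C) ->
     D \in P) ->
  connect (@adj (induced P)) A C.
Proof.
have [n] := ubnP #|~: val (val A)|.
elim: n A => // n IH A; rewrite ltnS => len hAC hP.
have [CA|nCA] := boolP (val (val C) \subset val (val A)).
  have -> : A = C; last exact: connect0.
  by do 2!apply: val_inj; apply/eqP; rewrite eqEsubset hAC.
have pAC : val (val A) \proper val (val C) by rewrite properE hAC.
have [D AD DC] := cover_exists pAC.
have [pAD _] := andP AD.
have DP : D \in P := hP D (proper_sub pAD) DC.
apply: (@connect_trans _ _ (Sub D DP)).
  by apply: connect1; rewrite /= /induced_adj /= /tree_adj AD.
apply: IH => //=.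
  by apply: leq_trans len; apply: proper_card; rewrite properC.
move=> E DE; apply: hP; exact: subset_trans (proper_sub pAD) DE.
Qed.

Lemma laminar_tree_connected : connected_graph laminar_tree.
Proof.
pose root : laminar_tree := Sub [set: G] LT.
split; first by apply/card_gt0P; exists root.
have toroot A : connect (@adj laminar_tree) A root.
  (* [interval_connect] speaks of induced subgraphs, so it is applied to the full node set and the
     path is projected back. *)
  have inT (C : laminar_tree) : C \in [set: laminar_tree] by rewrite inE.
  pose up C : induced [set: laminar_tree] := exist _ C (inT C).
  have /connectP[p pp lp] : connect (@adj (induced setT)) (up A) (up root).
    by apply: interval_connect => [|D _ _]; [apply: subsetT|apply: inT].
  apply/connectP; exists (map val p); first by rewrite -[A]/(val (up A)) path_map.
  by rewrite -[A]/(val (up A)) last_map -lp.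
move=> A C; apply: (connect_trans (toroot A)).
by rewrite (sym_connect_sym tree_adj_sym); apply: toroot.
Qed.

(* Two neighbours on a cycle of a smallest member would both cover it. *)
Lemma laminar_tree_acyclic : acyclic laminar_tree.
Proof.
move=> c /andP[cyc uc]; rewrite leqNgt; apply/negP => sz.
have [x0 x0c] : exists x, x \in c.
  by case: c sz {cyc uc} => // x; exists x; rewrite inE eqxx.
have [A Ac minA] := @arg_minnP _ x0 (mem c) (fun A : node => #|val A|) x0c.
have [i c' rotc] := rot_to Ac.
have up D : D \in c -> tree_adj A D -> covers A D.
  move=> Dc /orP[//|/andP[/proper_card]].
  by rewrite ltnNge minA.
move: cyc uc sz; rewrite -(rot_cycle i) -(rot_uniq i) -(size_rot i) rotc.
have memc D : D \in A :: c' -> D \in c by rewrite -rotc mem_rot.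
(* B and D are the two neighbours of A on the cycle, distinct because it has more than two nodes. *)
case/lastP: c' {rotc} memc => // -[|B c'] D memc //=.
rewrite rcons_path last_rcons => /andP[AB /andP[_ DA]] /and3P[_ BN _] _.
have BD : B = D.
  apply: (@covers_uniq A).
    by apply: up => //; apply: memc; rewrite !inE eqxx orbT.
  apply: up; last by rewrite tree_adj_sym.
  by apply: memc; rewrite !inE mem_rcons inE eqxx !orbT.
by move: BN; rewrite BD mem_rcons inE eqxx.
Qed.

Definition boundary (X : {set G}) :=
  [set v in X | [exists w, (v -- w) && (w \notin X)]].

Lemma boundaryP (X : {set G}) v :
  reflect (v \in X /\ exists2 w, v -- w & w \notin X) (v \in boundary X).
Proof.
rewrite inE; apply: (iffP andP) => -[vX].
  by case/existsP=> w /andP[vw wX]; split=> //; exists w.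
by case=> w vw wX; split=> //; apply/existsP; exists w; rewrite vw.
Qed.

Lemma card_boundary X : #|boundary X| <= cut X.
Proof.
apply: leq_trans (leq_imset_card (@snd G G) _); apply/subset_leq_card/subsetP => v.
case/boundaryP=> vX [w vw wX]; apply/imsetP; exists (w, v) => //.
by rewrite !inE /= adj_sym vw wX vX.
Qed.

Lemma card_outer_neighbours (X : {set G}) v : v \in X ->
  #|[set w | (v -- w) && (w \notin X)]| <= cut X.
Proof.
move=> vX; apply: leq_trans (leq_imset_card (@fst G G) _).
apply/subset_leq_card/subsetP => w; rewrite inE => /andP[vw wX].
by apply/imsetP; exists (w, v) => //; rewrite !inE /= adj_sym vw wX vX.
Qed.

(** Ranging over all smaller members instead of the children gives the same set, as a neighbour
    outside a child is outside every member within that child; it makes [bag_down] immediate. *)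
Definition bag (A : laminar_tree) : {set G} :=
  [set v in val A | [forall C : node,
     (val C \proper val A) && (v \in val C) ==> (v \in boundary (val C))]].

Lemma bagP A v :
  reflect (v \in val A /\ forall C : node, val C \proper val A -> v \in val C ->
             v \in boundary (val C))
          (v \in bag A).
Proof.
rewrite inE; apply: (iffP andP) => -[vA h]; split=> //.
  by move=> C CA vC; apply: (implyP (forallP h C)); rewrite CA.
by apply/forallP => C; apply/implyP => /andP[]; apply: h.
Qed.

Lemma bag_down A C v : val C \subset val A -> v \in bag A -> v \in val C ->
  v \in bag C.
Proof.
move=> CA /bagP[vA h] vC; apply/bagP; split=> // D DC.
exact: h (proper_sub_trans DC CA).
Qed.

Lemma bag_covers A C : covers C A -> bag C :&: bag A \subset boundary (val C).
Proof.
move=> /andP[CA _]; apply/subsetP => v /setIP[/bagP[vC _] /bagP[_ h]].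
exact: h.
Qed.

Lemma least_member (S : {set G}) : exists2 A : node, S \subset val A &
  forall C : node, S \subset val C -> #|val A| <= #|val C|.
Proof.
pose root : node := Sub [set: G] LT.
have [|A SA minA] := @arg_minnP _ root (fun A : node => S \subset val A)
  (fun A : node => #|val A|); first exact: subsetT.
by exists A.
Qed.

(** The members whose bags contain v form a chain, since they share v, and by [bag_down] no node
    between two of them is missing. The least member containing both ends of an edge has both in its
    bag: in any smaller member, one end has the other as an outside neighbour. *)
Lemma bag_tree_decomposition : tree_decomposition bag.
Proof.
split.
- by split; [apply: laminar_tree_connected|apply: laminar_tree_acyclic].
- move=> v; split.
    have [A vA minA] := least_member [set v].
    have vbA : A \in [set x : laminar_tree | v \in bag x].
      rewrite inE; apply/bagP; split=> [|C CA vC]; first by rewrite -sub1set.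
      by have := proper_card CA; rewrite ltnNge minA // sub1set.
    by apply/card_gt0P; exists (exist _ A vbA).
  have inbag (A : induced [set x : laminar_tree | v \in bag x]) :
      v \in bag (val A) by have := valP A; rewrite inE.
  have conn (A C : induced [set x : laminar_tree | v \in bag x]) :
      val (val A) \subset val (val C) ->
      connect (@adj (induced [set x : laminar_tree | v \in bag x])) A C.
    move=> hAC; apply: interval_connect => // D AD DC; rewrite inE.
    have /bagP[vA _] := inbag A.
    by apply: bag_down DC (inbag C) _; apply: (subsetP AD).
  move=> A C.
  have /bagP[vA _] := inbag A; have /bagP[vC _] := inbag C.
  case: (common_nested vA vC) => h; first exact: conn.
  by rewrite (sym_connect_sym (@induced_adj_sym _ _)); apply: conn.
- move=> u v uv; have [A uvA minA] := least_member [set u; v].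
  have inA a b : [set a; b] = [set u; v] -> a -- b -> a \in bag A.
    move=> Eab ab; apply/bagP; split=> [|C CA aC].
      by apply: (subsetP uvA); rewrite -Eab set21.
    apply/boundaryP; split=> //; exists b => //; apply/negP => bC.
    have := proper_card CA; rewrite ltnNge minA // -Eab.
    by apply/subsetP => x /set2P[]->.
  by exists A; split; [apply: (inA u v)|apply: (inA v u); rewrite 1?setUC 1?adj_sym].
Qed.

Variable k : nat.
Hypothesis L_cut : forall X : {set G}, X \in L -> cut X <= k.

Lemma card_boundary_node A : #|boundary (val A)| <= k.
Proof. exact: leq_trans (card_boundary _) (L_cut (valP A)). Qed.

Lemma bag_adhesion : adhesion bag <= k.
Proof.
apply/bigmax_leqP => -[A C] /= /orP[/bag_covers|/bag_covers] /subset_leq_card le.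
  exact: leq_trans le (card_boundary_node A).
by rewrite setIC; apply: leq_trans le (card_boundary_node C).
Qed.

Definition core A := [set v in val A | [forall C : node,
  (val C \proper val A) ==> (v \notin val C)]].

(** A member meeting the core of A is nested with A but not properly inside it, so it contains all
    of A. *)
Lemma core_separates A u v X : u \in core A -> v \in core A -> X \in L ->
  ~~ separates X u v.
Proof.
rewrite !inE => /andP[uA /forallP cu] /andP[vA /forallP cv] XL.
pose C : node := Sub X XL.
have nested x : x \in val A -> (val C \proper val A -> x \notin X) -> x \in X ->
    val A \subset X.
  move=> xA nx xX; case: (@common_nested A C x xA xX) => // CA.
  by apply: contraTT xX => nAC; apply: nx; rewrite properE CA.
rewrite /separates negbK; apply/eqP; apply/idP/idP => xX.
  exact: (subsetP (nested u uA (implyP (cu C)) xX)).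
exact: (subsetP (nested v vA (implyP (cv C)) xX)).
Qed.

(* Outside the core, v lies in a child C of A; the only adhesion sets through v
   are then the boundaries of C and of A. *)
Lemma torso_degree A (v : torso bag A) : val v \notin core A ->
  degree v <= 3 * k.
Proof.
have vb := valP v; have /bagP[vA _] := vb; rewrite inE vA /= => /forallPn[C0].
rewrite negb_imply negbK => /andP[pC0 vC0].
have [|C CA vC] := cocover_exists vA; first by exists C0.
have [pCA _] := andP CA.
have Cbd x : x \in bag A -> x \in val C -> x \in boundary (val C).
  by case/bagP=> _; apply.
rewrite /degree -(card_imset _ val_inj).
set N := imset _ _.
(* Each of these three sets has at most k elements. *)
have sN : N \subset boundary (val C) :|: boundary (val A) :|:
    [set w | (val v -- w) && (w \notin val C)].
  apply/subsetP => _ /imsetP[w + ->]; rewrite inE => vw.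
  have wb := valP w.
  case: (boolP (val w \in val C)) => wC.
    by rewrite !in_setU Cbd.
  case/orP: vw => [vw|/andP[_ /existsP[D /and3P[AD /setIP[_ vD] /setIP[_ wD]]]]].
    by rewrite in_setU in_set wC andbT; apply/orP; right.
  case/orP: AD => [/bag_covers|DA].
    by move/subsetP/(_ (val w)); rewrite inE wb wD !in_setU => ->; rewrite ?orbT.
  (* Here D is a child of A sharing v with C; maximality of C places D, and with it w, inside C. *)
  have [pDA _] := andP DA.
  case/bagP: vD => vD _; case/bagP: wD => wD _; case/negP: wC.
  have [_ /forallP CAmax] := andP CA; have [_ /forallP DAmax] := andP DA.
  case: (common_nested vC vD) => h; last exact: (subsetP h).
  have := CAmax D; rewrite pDA /= implybF properE h /= negbK => h'.
  exact: (subsetP h').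
apply: leq_trans (subset_leq_card sN) _.
apply: leq_trans (leq_card_setU _ _) _.
rewrite (_ : 3 * k = k + k + k); last by rewrite !mulSn mul0n addn0 addnA.
apply: leq_add; last exact: leq_trans (card_outer_neighbours vC) (L_cut (valP C)).
apply: leq_trans (leq_card_setU _ _) _.
by apply: leq_add; apply: card_boundary_node.
Qed.

Lemma torso_bounded_degree A c d : #|core A| <= c -> 3 * k <= d ->
  bounded_degree c d (torso bag A).
Proof.
move=> hc hd; apply: leq_trans hc.
rewrite -(card_imset _ val_inj); apply/subset_leq_card/subsetP => _ /imsetP[v + ->].
rewrite inE; apply: contraTT => /torso_degree le.
by rewrite -leqNgt; apply: leq_trans le hd.
Qed.

End LaminarTree.

(** * Small cores and the conclusion *)

Lemma card_injection (S T : finType) (X : {set T}) : #|S| <= #|X| ->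
  exists2 f : S -> T, injective f & forall a, f a \in X.
Proof.
move=> leSX; exists (fun a => enum_val (widen_ord leSX (enum_rank a))).
  move=> a b /enum_val_inj E; apply/enum_rank_inj/val_inj.
  exact: (congr1 (@nat_of_ord _) E).
by move=> a; apply: enum_valP.
Qed.

Lemma card_core (H G : sgraph) A : ~ weak_immersion H G ->
  #|@core G (cut_family G (#|H| ^ 2)) A| <= #|H|.
Proof.
move=> noH; rewrite leqNgt; apply/negP => ltHA; apply: noH.
have [s sA] : exists s, s \in core A by apply/card_gt0P; apply: leq_ltn_trans ltHA.
have [|f injf fA] := @card_injection H G (core A :\ s).
  by move: ltHA; rewrite (cardsD1 s) sA.
apply: (immersion_of_hub (s := s) injf) => X sX [v vX].
rewrite leqNgt; apply/negP => /ltnW cX.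
have sepX : separates X (f v) s by rewrite /separates vX (negPf sX).
(* A small cut between [f v] and the hub would yield a member of the family separating two core
   vertices. *)
have [Y YL] := cut_family_separates cX sepX; apply/negP.
apply: (core_separates (@cut_family_laminar _ _) _ sA YL).
by have := fA v; rewrite in_setD1 => /andP[].
Qed.

Theorem theorem9 (t : nat) (H : sgraph) (hH : #|H| = t)
  (G : sgraph) (hG : ~ weak_immersion H G) :
  exists (T : sgraph) (B : T -> {set G}),
    [/\ tree_decomposition B,
        adhesion B <= t ^ 2
      & forall x : T, bounded_degree t (t ^ 4 + 2 * t ^ 2) (torso B x)].
Proof.
rewrite -{}hH; set L := cut_family G (#|H| ^ 2).
have lamL : laminar L := @cut_family_laminar _ _.
have LT : [set: G] \in L by rewrite /L !inE eqxx.
have L0 A : A \in L -> A = setT \/ A != set0 by apply: cut_family_neq0.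
have Lcut A : A \in L -> cut A <= #|H| ^ 2 by apply: cut_family_cut.
exists (laminar_tree L), (@bag G L); split.
- exact: bag_tree_decomposition.
- exact: bag_adhesion.
- move=> A; apply: (torso_bounded_degree lamL Lcut); first exact: card_core.
  (* The torso bound is 3 t^2, and t^2 is at most t^4. *)
  rewrite mulSn leq_add2r (expnM #|H| 2 2).
  by case: (#|H| ^ 2) => // n; rewrite -mulnn leq_pmulr.
Qed.
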